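(* Let $a,b$ be positive integers and let $l$ be the integer with $0 \le l < b$ and $a\equiv l \pmod b$. If $l \in \{0,1\}$, then $$ a\, M_2(a;b) = \left\lfloor \frac a b \right\rfloor \frac{(b-1)b(2b-1)}{6}. $$ If $l \ge 2$, then $$ a\, M_2(a;b) \ge \left\lfloor \frac a b \right\rfloor \frac{(b-1)b(2b-1)}{6} + \left\lfloor \frac b l \right\rfloor^2 \frac{(l-1)l(2l-1)}{6} $$ and $$ a\, M_2(a;b) \le \left\lfloor \frac a b \right\rfloor \frac{(b-1)b(2b-1)}{6} + \left\lfloor \frac{b^2(l-1)(2l-1)}{6l} \right\rfloor . $$
   Context: For positive integers $a,b$, $M_2(a;b) = \frac 1 a \sum_{m=0}^{a-1} \left\lfloor \frac{mb}{a}\right\rfloor^2$, where $\lfloor x\rfloor$ is the greatest integer not exceeding $x$. *)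

(* Defs.v *)
From mathcomp Require Import all_boot all_order all_algebra.

Set Implicit Arguments.
Unset Strict Implicit.
Unset Printing Implicit Defensive.

Import Order.TTheory GRing.Theory Num.Theory.

Local Open Scope ring_scope.

(* All arithmetic takes place in rat, so subtractions and quotients of the
   cast naturals are exact; truncation only happens through Num.floor. *)
Definition M2 (a b : nat) : rat :=
  1 / a%:R *
  \sum_(0 <= m < a) (Num.floor ((m%:R * b%:R) / a%:R : rat))%:~R ^+ 2.

(* Main.v *)
Require Import Defs.
From mathcomp Require Import all_boot all_order all_algebra.
From mathcomp Require Import zify ring.

Set Implicit Arguments.
Unset Strict Implicit.
Unset Printing Implicit Defensive.

Import Order.TTheory GRing.Theory Num.Theory.

(** Write S(a, b) for the sum of the squares of floor(mb/a) over 0 <= m < a, so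
    that a M_2(a; b) = S(a, b). Each square x ^ 2 is the sum of the odd numbers
    2n+1 with n < x; exchanging the two summations turns S(a, b) into a count of
    lattice points, and the reflection m |-> a - m evaluates that count:

      S(a, b) = \sum_(n < b) (2n+1) floor((b-1-n) a / b)

    ([sum_sq_floorE]). On the right a is the numerator, so replacing a by
    q b + l adds q (b-1-n) to the n-th floor exactly. The coefficient of q so
    obtained is the value of the same formula at a = b, that is S(b, b), the sum
    of the first squares. Hence ([sum_sq_floorMD])

      S(q b + l, b) = q (b-1) b (2b-1) / 6 + S(l, b).

    When l <= 1 every term of S(l, b) vanishes. When l >= 2 both bounds on
    S(l, b) come term by term from m floor(b/l) <= floor(mb/l) <= mb/l; the upper
    one may then be rounded down because S(l, b) is an integer. *)

Definition sum_sq_floor (a b : nat) : nat :=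
  \sum_(0 <= m < a) (m * b %/ a) ^ 2.

(** The layer-cake form of a square: each square becomes a sum over one range
    [0, b) that does not depend on x, so that squares of different numbers can
    be added by exchanging summations. *)
Lemma sqn_sum_odd (x b : nat) : x <= b ->
  x ^ 2 = \sum_(0 <= n < b) (n < x) * (2 * n + 1).
Proof.
have sum_all k : \sum_(0 <= n < k) (2 * n + 1) = k ^ 2.
  elim: k => [|k IHk]; first by rewrite big_geq.
  by rewrite big_nat_recr //= IHk; lia.
move=> le_xb; rewrite -sum_all (big_nat_widen _ _ b) // big_mkcond /=.
by apply: eq_bigr => n _; case: (n < x); rewrite ?mul1n.
Qed.

(** After the substitution m |-> a - m the condition (n+1) a <= m b becomes
    m b <= (b-1-n) a with 1 <= m <= a, whose solutions are the m from 1 up to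
    the floor on the right. *)
Lemma count_lattice_column (a b n : nat) : n < b ->
  \sum_(0 <= m < a) (n.+1 * a <= m * b) = (b - n.+1) * a %/ b.
Proof.
move=> lt_nb; have b_gt0 : 0 < b by lia.
set d := _ %/ b.
have le_da : d <= a.
  by rewrite -[leqRHS](mulKn a b_gt0) leq_div2r // leq_mul2r leq_subr orbT.
rewrite big_nat_rev /= add0n.
have {1}-> : d = \sum_(0 <= m < a) (m < d).
  rewrite -{1}(subn0 d) -(muln1 (d - 0)) -sum_nat_const_nat.
  rewrite (big_nat_widen _ _ a) // big_mkcond /=.
  by apply: eq_bigr => m _; case: (m < d).
apply: eq_big_nat => m /andP[_ lt_ma].
rewrite /d leq_divRL //; congr nat_of_bool.
have -> : (a - m.+1) * b = a * b - m.+1 * b by rewrite mulnBl.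
have -> : (b - n.+1) * a = a * b - n.+1 * a by rewrite mulnBl (mulnC b).
have : m.+1 * b <= a * b by apply: leq_mul.
have : n.+1 * a <= a * b by rewrite mulnC; apply: leq_mul.
lia.
Qed.

(** The layers run up to b because mb/a < b for every m < a. *)
Lemma sum_sq_floorE (a b : nat) :
  sum_sq_floor a b =
    \sum_(0 <= n < b) (2 * n + 1) * ((b - n.+1) * a %/ b).
Proof.
rewrite /sum_sq_floor.
under eq_big_nat => m /andP[_ lt_ma].
  have a_gt0 : 0 < a by lia.
  rewrite (@sqn_sum_odd _ b); last first.
    by rewrite -[leqRHS](mulKn b a_gt0) leq_div2r // leq_mul2r ltnW ?orbT.
  under eq_bigr do rewrite leq_divRL //.
  over.
rewrite exchange_big /=; apply: eq_big_nat => n /andP[_ lt_nb].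
rewrite -(@count_lattice_column a b n) // big_distrr /=.
by apply: eq_bigr => m _; rewrite mulnC.
Qed.

Lemma sum_sq_floor_diag (b : nat) :
  sum_sq_floor b b = \sum_(0 <= m < b) m ^ 2.
Proof.
by apply: eq_big_nat => m /andP[_ lt_mb]; rewrite mulnK //; lia.
Qed.

Lemma sum_sq_floorMD (q l b : nat) :
  sum_sq_floor (q * b + l) b =
    q * (\sum_(0 <= m < b) m ^ 2) + sum_sq_floor l b.
Proof.
(* Written as S(b, b), the coefficient of q expands by the same formula, with
   floors (b-1-n) b / b that are exact. *)
rewrite -sum_sq_floor_diag !sum_sq_floorE big_distrr /= -big_split /=.
apply: eq_big_nat => n /andP[_ lt_nb]; have b_gt0 : 0 < b by lia.
rewrite mulnDr (mulnA _ q) divnMDl // mulnK //; lia.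
Qed.

Lemma sum_sq_floor_le1 (l b : nat) : l <= 1 -> sum_sq_floor l b = 0.
Proof.
case: l => [|[|//]] _; first by rewrite /sum_sq_floor big_geq.
by rewrite /sum_sq_floor big_nat1 mul0n div0n.
Qed.

Lemma sum_sq_floor_ge (l b : nat) :
  (b %/ l) ^ 2 * (\sum_(0 <= m < l) m ^ 2) <= sum_sq_floor l b.
Proof.
rewrite big_distrr /= /sum_sq_floor; case: l => [|l]; first by rewrite !big_geq.
apply: leq_sum => m _; rewrite -expnMn leq_sqr leq_divRL //.
by rewrite mulnAC mulnC leq_mul2l leq_trunc_div orbT.
Qed.

Local Open Scope ring_scope.

Lemma floor_divn (x y : nat) : (0 < y)%N ->
  Num.floor (x%:R / y%:R : rat) = (x %/ y)%N%:Z.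
Proof.
move=> y_gt0; apply: floor_def.
have y_pos : 0 < (y%:R : rat) by rewrite ltr0n.
rewrite ler_pdivlMr // ltr_pdivrMr // intrD mulr1z -!pmulrn natr1.
by rewrite -!natrM ler_nat ltr_nat leq_trunc_div ltn_ceil.
Qed.

Lemma natr_sum_sqn (n : nat) :
  (\sum_(0 <= m < n) m ^ 2)%N%:R =
    (n%:R - 1) * n%:R * (2 * n%:R - 1) / 6 :> rat.
Proof.
elim: n => [|n IHn]; first by rewrite big_geq // mulr0 !mul0r.
by rewrite big_nat_recr //= natrD IHn natrX -natr1; field.
Qed.

Lemma mulr_M2 (a b : nat) : (0 < a)%N ->
  a%:R * M2 a b = (sum_sq_floor a b)%:R.
Proof.
move=> a_gt0; rewrite /M2 mulrA mul1r divff ?pnatr_eq0 -?lt0n // mul1r.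
rewrite natr_sum; apply: eq_bigr => m _.
by rewrite -natrM floor_divn // natrX -pmulrn.
Qed.

Lemma sum_sq_floor_le (l b : nat) : (0 < l)%N ->
  (sum_sq_floor l b)%:R <=
    b%:R ^+ 2 * (l%:R - 1) * (2 * l%:R - 1) / (6 * l%:R) :> rat.
Proof.
move=> l_gt0; have l_pos : 0 < (l%:R : rat) by rewrite ltr0n.
have -> : b%:R ^+ 2 * (l%:R - 1) * (2 * l%:R - 1) / (6 * l%:R) =
    (b%:R / l%:R) ^+ 2 * (\sum_(0 <= m < l) m ^ 2)%N%:R :> rat.
  by rewrite natr_sum_sqn; field; rewrite gt_eqF.
rewrite !natr_sum big_distrr /=; apply: ler_sum => m _.
rewrite !natrX -exprMn lerXn2r ?nnegrE ?mulr_ge0 ?invr_ge0 ?ler0n //.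
by rewrite mulrAC ler_pdivlMr // -!natrM ler_nat (mulnC b) leq_trunc_div.
Qed.

Theorem theorem2 (a b l : nat) (ha : (0 < a)%N) (hb : (0 < b)%N)
    (hlb : (l < b)%N) (hal : a = l %[mod b]) :
  (l = 0%N \/ l = 1%N ->
    a%:R * M2 a b =
      (Num.floor (a%:R / b%:R : rat))%:~R *
        ((b%:R - 1) * b%:R * (2 * b%:R - 1) / 6)) /\
  ((2 <= l)%N ->
    (Num.floor (a%:R / b%:R : rat))%:~R *
        ((b%:R - 1) * b%:R * (2 * b%:R - 1) / 6)
      + (Num.floor (b%:R / l%:R : rat))%:~R ^+ 2 *
        ((l%:R - 1) * l%:R * (2 * l%:R - 1) / 6)
      <= a%:R * M2 a b /\
    a%:R * M2 a b <=
      (Num.floor (a%:R / b%:R : rat))%:~R *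
        ((b%:R - 1) * b%:R * (2 * b%:R - 1) / 6)
      + (Num.floor (b%:R ^+ 2 * (l%:R - 1) * (2 * l%:R - 1)
                      / (6 * l%:R) : rat))%:~R).
Proof.
have decomp : a%:R * M2 a b =
    (Num.floor (a%:R / b%:R : rat))%:~R *
        ((b%:R - 1) * b%:R * (2 * b%:R - 1) / 6) + (sum_sq_floor l b)%:R.
  rewrite mulr_M2 // floor_divn // -pmulrn -natr_sum_sqn -natrM -natrD.
  by rewrite -sum_sq_floorMD -(modn_small hlb) -hal -divn_eq.
rewrite decomp; split=> [l01 | l_ge2].
  by rewrite sum_sq_floor_le1 ?addr0 //; case: l01 => ->.
have l_gt0 : (0 < l)%N by apply: ltnW.
split; rewrite lerD2l.
  rewrite floor_divn // -pmulrn -natr_sum_sqn -natrX -natrM ler_nat.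
  exact: sum_sq_floor_ge.
by rewrite pmulrn ler_int floor_ge_int -pmulrn sum_sq_floor_le.
Qed.
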